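(* Let $\Gamma\rightrightarrows M$ and $\Delta\rightrightarrows N$ be Lie groupoids. Every effective equivalence $\phi:\Gamma\to\Delta$ induces a homeomorphism $M/\Gamma\to N/\Delta$ between the orbit space of $\Gamma$ and the orbit space of $\Delta$.
   Context: Smooth manifolds are non-empty, $C^\infty$, of constant dimension, Hausdorff and second countable. A Lie groupoid $\Gamma\rightrightarrows X$ is a groupoid (small category with all arrows invertible) whose set of objects $X$ (its base) and set of arrows (also written $\Gamma$) are smooth manifolds, with source $s$ and target $t$ submersive $C^\infty$ maps and composition, unit and inverse maps of class $C^\infty$. The product $g'g$ is defined when $sg'=tg$. $\Gamma^x=s^{-1}(x)$; $\Gamma(x,y)=\Gamma^x_y$ is the set of arrows from $x$ to $y$. Homomorphisms are $C^\infty$ functors; $\phi$ also denotes the base map. The orbit space $X/\Gamma$ is the quotient of $X$, with the quotient topology, by the relation identifying two points connected by an arrow; a homomorphism induces a continuous map of orbit spaces. Ineffective isotropy. For $x\in X$ the isotropy group $\Gamma^x_x$ acts freely from the right on $\Gamma^x$, and the orbit $O_x=\Gamma^x/\Gamma^x_x$ carries the unique differentiable structure making the projection a submersion; the target map induces an injective immersion $O_x\to X$. The longitudinal tangent space $L_x\Gamma\subset T_xX$ is the image of the tangent map of this immersion at the class of $1_x$, and the transversal tangent space is $N_x\Gamma=T_xX/L_x\Gamma$. For an arrow $g\in\Gamma(x,x')$ choose a local $C^\infty$ section $\gamma$ of $s$ near $x$ with $\gamma(x)=g$; then $T_x(t\circ\gamma)$ maps $L_x\Gamma$ into $L_{x'}\Gamma$,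 and the induced linear map $\varepsilon(g):N_x\Gamma\to N_{x'}\Gamma$ (the effect of $g$) does not depend on $\gamma$. The ineffective isotropy group at $x$ is $\dot\Gamma^x_x=\{g\in\Gamma^x_x:\varepsilon(g)=\mathrm{id}\}$. The category $\mathbf{LGpd}^{\bullet}$ has as objects all Lie groupoids and as morphisms the homomorphisms $\phi:\Gamma\to\Delta$ with $\phi(\dot\Gamma^x_x)\subset\dot\Delta^{\phi x}_{\phi x}$ for every base point $x$ of $\Gamma$. For arrows $h_1,h_2$ of $\Delta$, write $h_1\equiv h_2\pmod{\dot\Delta}$ if $sh_1=sh_2=y$, $th_1=th_2$ and $h_2^{-1}h_1\in\dot\Delta^y_y$. A natural congruence between homomorphisms $\phi,\psi:\Gamma\to\Delta$ is a $C^\infty$ map $\tau$ from the base of $\Gamma$ to the arrows of $\Delta$ with $\tau(x)\in\Delta(\phi x,\psi x)$ for all $x$ and $\tau(tg)\phi(g)\equiv\psi(g)\tau(sg)\pmod{\dot\Delta}$ for all arrows $g\in\Gamma$. Write $\phi\cong\psi$ if a natural congruence exists; this is a categorical congruence on $\mathbf{LGpd}^{\bullet}$. $\mathbf{LGpd}^{\bullet}_{/\cong}$ is the quotient category, with morphisms the classes $[\phi]$. A homomorphism $\phi:\Gamma\to\Delta$ of Lie groupoids, with base map $f:X\to Y$, is transversal if the map $\{(x,h)\in X\times\Delta:f(x)=t(h)\}\to Y$, $(x,h)\mapsto s(h)$, is a submersion, and completely transversal if this map is a surjective submersion. It is full if it is full as an abstract functor. Every transversal homomorphism belongs to $\mathbf{LGpd}^{\bullet}$.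 $\mathcal E$ denotes the class of full, completely transversal homomorphisms of Lie groupoids, and also its image in $\mathbf{LGpd}^{\bullet}_{/\cong}$; $\mathbf{LGpd}^{\bullet}_{/\cong}[\mathcal E^{-1}]$ is the localization formally inverting $\mathcal E$. An effective equivalence is a morphism of $\mathbf{LGpd}^{\bullet}$ whose image under the canonical functor $\mathbf{LGpd}^{\bullet}\to\mathbf{LGpd}^{\bullet}_{/\cong}[\mathcal E^{-1}]$ is an isomorphism. *)

(* Defs.v *)
From HB Require Import structures.
From mathcomp Require Import all_boot all_order all_algebra generic_quotient.
From mathcomp Require Import all_classical all_reals all_analysis.

Set Implicit Arguments.
Unset Strict Implicit.
Unset Printing Implicit Defensive.
Import Order.TTheory GRing.Theory Num.Theory.
Import numFieldNormedType.Exports.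
Local Open Scope classical_set_scope.
Local Open Scope ring_scope.
Local Open Scope quotient_scope.

(** * Smooth maps between open subsets of normed spaces *)

Section SmoothEuclidean.
Context {R : realType}.

(* Meaningful for [A] open: the derivatives use the values of [f] near the
   points of [A]. *)
Fixpoint Ck (V W : normedModType R) (k : nat) (A : set V) (f : V -> W) : Prop :=
  match k with
  | 0 => forall x, A x -> {for x, continuous f}
  | k'.+1 => (forall x, A x -> differentiable f x) /\
             (forall v, Ck k' A ('D_v f))
  end.

Definition Cinfty (V W : normedModType R) (A : set V) (f : V -> W) : Prop :=
  forall k, Ck k A f.

Lemma near_eq_differentiable (V W : normedModType R) (f g : V -> W) x :
  (\forall y \near x, f y = g y) -> differentiable f x -> differentiable g x.
Proof.
move=> fg df; pose h := g - f.
suff dh : differentiable h x.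
  by have -> : g = h + f; [rewrite /h subrK | exact: differentiableD].
have E : h \o shift x = cst (h x) + (0 : V -> W) +o_ 0 id.
  apply/eqaddoP => e e0.
  have : \forall y \near (0 : V), f (y + x) = g (y + x).
    by move: fg; rewrite (near_shift 0) subr0.
  apply: filterS => y /= yfg.
  rewrite /h !fctE (nbhs_singleton fg) yfg !subrr addr0 subrr normr0.
  by rewrite mulr_ge0 ?normr_ge0 ?ltW.
apply/diff_locallyP.
have -> : 'd h x = (0 : V -> W) :> (V -> W).
  by apply: (@diff_unique _ _ _ _ (\0 : {linear V -> W})) => //; exact: cst_continuous.
by split => //; exact: cst_continuous.
Qed.

Lemma Ck_ext (V W : normedModType R) k (A : set V) (f g : V -> W) :
  open A -> (forall x, A x -> f x = g x) -> Ck k A f -> Ck k A g.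
Proof.
move=> oA; elim: k f g => [|k IH] f g fg /=.
  move=> cf x Ax; have fgn : \forall y \near x, f y = g y.
    by apply: (filterS fg); exact: open_nbhs_nbhs.
  rewrite /prop_for/continuous_at -(fg _ Ax).
  by apply: cvg_trans (cf _ Ax); exact: near_eq_cvg.
move=> [df Df]; split=> [x Ax|v].
  apply: near_eq_differentiable (df _ Ax).
  by apply: (filterS fg); exact: open_nbhs_nbhs.
apply: IH (Df v) => x Ax; apply: near_eq_derive.
by apply: (filterS fg); exact: open_nbhs_nbhs.
Qed.

Lemma Ck_local (V W : normedModType R) k (A : set V) (f : V -> W) :
  (forall x, A x -> exists2 B, B x & Ck k B f) -> Ck k A f.
Proof.
elim: k f => [|k IH] f /= H.
  by move=> x /H [B Bx]; apply.
split=> [x /H[B Bx [df _]]|v]; first exact: df.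
by apply: IH => x /H[B Bx [_ Df]]; exists B.
Qed.

Lemma CkS (V W : normedModType R) k (A : set V) (f : V -> W) :
  Ck k.+1 A f -> Ck k A f.
Proof.
elim: k f => [|k IH] f /= [df Df].
  by move=> x /df; exact: differentiable_continuous.
by split => // v; apply: IH; exact: Df.
Qed.

Lemma Ck_cst (V W : normedModType R) k (A : set V) (c : W) : Ck k A (fun=> c).
Proof.
elim: k c => [|k IH] c /=; first by move=> x _; exact: cst_continuous.
split=> [x _|v]; first exact: differentiable_cst.
have -> : 'D_v (fun=> c) = (fun=> 0); last exact: IH.
by apply/funext => x; exact: derive_cst.
Qed.

Lemma CkD (V W : normedModType R) k (A : set V) (f g : V -> W) :
  open A -> Ck k A f -> Ck k A g -> Ck k A (fun x => f x + g x).
Proof.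
move=> oA; elim: k f g => [|k IH] f g /=.
  by move=> cf cg x Ax; apply: cvgD; [exact: cf|exact: cg].
move=> [df Df] [dg Dg]; split=> [x Ax|v].
  by apply: (@differentiableD _ _ _ f g); [exact: df|exact: dg].
apply: (Ck_ext oA _ (IH _ _ (Df v) (Dg v))) => x Ax.
by rewrite -deriveD//; apply: diff_derivable; [exact: df|exact: dg].
Qed.

Lemma Ck_sum (V W : normedModType R) k (A : set V) n (f : 'I_n -> V -> W) :
  open A -> (forall i, Ck k A (f i)) -> Ck k A (fun x => \sum_i f i x).
Proof.
move=> oA; elim: n f => [|n IH] f Hf.
  by under eq_fun do rewrite big_ord0; exact: Ck_cst.
under eq_fun do rewrite big_ord_recr /=.
by apply: CkD => //; exact: IH.
Qed.

Lemma CkM (V : normedModType R) k (A : set V) (f g : V -> R^o) :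
  open A -> Ck k A f -> Ck k A g -> Ck k A (fun x => f x * g x : R^o).
Proof.
move=> oA; elim: k f g => [|k IH] f g.
  by move=> cf cg x Ax; apply: cvgM; [exact: cf|exact: cg].
move=> Cf Cg; have [df Df] := Cf; have [dg Dg] := Cg; split=> [x Ax|v].
  by apply: (@differentiableM _ _ f g); [exact: df|exact: dg].
apply: (Ck_ext (f := fun x => f x * ('D_v g x) + g x * 'D_v f x)) => //.
  move=> x Ax; rewrite (deriveM (f:=f) (g:=g)) //.
    by apply: diff_derivable; exact: df.
  by apply: diff_derivable; exact: dg.
apply: CkD => //; apply: IH.
- exact: CkS.
- exact: Dg.
- exact: CkS.
- exact: Df.
Qed.

Lemma differentiable_mxP (V : normedModType R) n (f : V -> 'rV[R]_n) x :
  (forall j, differentiable (fun y => f y 0 j : R^o) x) -> differentiable f x.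
Proof.
move=> df.
have -> : f = \sum_j (fun y => f y 0 j *: (delta_mx 0 j : 'rV[R]_n)).
  by apply/funext => y; rewrite fct_sumE [LHS]row_sum_delta.
by apply: differentiable_sum => j; exact: differentiableZl.
Qed.

Lemma Ck_mxP (V : normedModType R) n k (A : set V) (f : V -> 'rV[R]_n) :
  open A -> Ck k A f <-> forall j, Ck k A (fun x => f x 0 j : R^o).
Proof.
move=> oA; elim: k f => [|k IH] f.
  split=> [cf j x Ax|cf x Ax].
    by apply: (@continuous_comp _ _ _ f (fun M : 'rV[R]_n => M 0 j : R^o)); [exact: cf|exact: coord_continuous].
  have fE y : \sum_j (f y 0 j *: (delta_mx 0 j : 'rV[R]_n)) = f y.
    by rewrite [RHS]row_sum_delta.
  rewrite /prop_for /continuous_at -fE; under eq_cvg do rewrite -fE.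
  apply: cvg_big => [|j _]; first exact: add_continuous.
  by apply: cvgZr_tmp; exact: (cf j).
split=> [[df Df] j|Hf]; split.
- move=> x Ax; apply: (@differentiable_comp _ _ _ _ f (fun M : 'rV[R]_n => M 0 j : R^o)); first exact: df.
  exact: differentiable_coord.
- move=> v; have /IH/(_ j) := Df v.
  apply: Ck_ext => // x Ax; rewrite derive_mx ?mxE //.
  exact/diff_derivable/df.
- move=> x Ax; apply: differentiable_mxP => j; exact: (Hf j).1.
- move=> v; apply/IH => j; have := (Hf j).2 v; apply: Ck_ext => // x Ax.
  rewrite derive_mx ?mxE //; apply/derivable_mxP => i j'; rewrite ord1.
  by apply/diff_derivable; exact: (Hf j').1.
Qed.

Lemma Ck_comp_scalar (V : normedModType R) n k (A : set V) (B : set 'rV[R]_n)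
    (g : V -> 'rV[R]_n) (F : 'rV[R]_n -> R^o) :
  open A -> (forall x, A x -> B (g x)) ->
  Ck k A g -> Ck k B F -> Ck k A (F \o g).
Proof.
move=> oA AB; elim: k F => [|k IH] F.
  by move=> cg cF x Ax; apply: continuous_comp; [exact: cg|exact/cF/AB].
move=> Cg [dF DF]; have [dg Dg] := Cg; split=> [x Ax|v].
  by apply: differentiable_comp; [exact: dg|exact/dF/AB].
apply: (Ck_ext (f := fun x => \sum_j ('D_v g x) 0 j *
                    ('D_(delta_mx 0 j) F \o g) x)) => //.
  move=> x Ax; have dgx := dg _ Ax; have dFx := dF _ (AB _ Ax).
  have dFg : differentiable (F \o g) x by apply: differentiable_comp.
  rewrite (deriveE _ dFg) (diff_comp dgx dFx) /= -(deriveE _ dgx).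
  rewrite [X in 'd F _ X]row_sum_delta linear_sum; apply: eq_bigr => j _.
  by rewrite linearZ/= -(deriveE _ dFx) .
have CgS := CkS Cg.
apply: Ck_sum => // j; apply: CkM => //; last exact: (IH _ CgS (DF _)).
exact: ((Ck_mxP _ _ oA).1 (Dg v) j).
Qed.

Lemma Ck_comp (V : normedModType R) n p k (A : set V) (B : set 'rV[R]_n)
    (g : V -> 'rV[R]_n) (F : 'rV[R]_n -> 'rV[R]_p) :
  open A -> open B -> (forall x, A x -> B (g x)) ->
  Ck k A g -> Ck k B F -> Ck k A (F \o g).
Proof.
move=> oA oB AB Cg CF; apply/Ck_mxP => // j.
apply: (Ck_comp_scalar oA AB Cg (F := fun y => F y 0 j)).
exact: ((Ck_mxP _ _ oB).1 CF j).
Qed.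

End SmoothEuclidean.

(** * Manifolds *)

Section Manifolds.
Context {R : realType}.

(* A homeomorphism from an open subset of [T] onto an open subset of R^n; the
   values of [chart_fun] and [chart_inv] outside these subsets are junk. *)
Record chart (T : topologicalType) (n : nat) := Chart {
  chart_dom : set T;
  chart_img : set 'rV[R]_n;
  chart_fun : T -> 'rV[R]_n;
  chart_inv : 'rV[R]_n -> T;
  chart_dom_open : open chart_dom;
  chart_img_open : open chart_img;
  chart_funP : forall x, chart_dom x -> chart_img (chart_fun x);
  chart_invP : forall z, chart_img z -> chart_dom (chart_inv z);
  chart_funK : forall x, chart_dom x -> chart_inv (chart_fun x) = x;
  chart_invK : forall z, chart_img z -> chart_fun (chart_inv z) = z;
  chart_fun_cont : forall x, chart_dom x -> {for x, continuous chart_fun};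
  chart_inv_cont : forall z, chart_img z -> {for z, continuous chart_inv}
}.

(* The atlas is not required to be maximal: two atlases defining the same
   smooth structure give manifolds that are diffeomorphic by the identity. *)
Record manifold := Manifold {
  mfd_sort :> topologicalType;
  mfd_dim : nat;
  atlas : set (chart mfd_sort mfd_dim);
  mfd_nonempty : [set: mfd_sort] !=set0;
  mfd_hausdorff : hausdorff_space mfd_sort;
  mfd_second_countable : @second_countable mfd_sort;
  atlas_cover : forall x : mfd_sort, exists2 c, atlas c & chart_dom c x;
  atlas_compat : forall c d, atlas c -> atlas d ->
    Cinfty [set z | chart_img c z /\ chart_dom d (chart_inv c z)]
           (chart_fun d \o chart_inv c)
}.

(* Smoothness on an open subset [U] of [M] *)
Definition smooth_on (M N : manifold) (U : set M) (f : M -> N) : Prop :=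
  (forall x, U x -> {for x, continuous f}) /\
  (forall c d, atlas c -> atlas d ->
    Cinfty [set z | [/\ chart_img c z, U (chart_inv c z)
                      & chart_dom d (f (chart_inv c z))]]
           (chart_fun d \o f \o chart_inv c)).

Definition smooth (M N : manifold) (f : M -> N) : Prop := smooth_on setT f.

Lemma chart_open (T : topologicalType) n (c : chart T n) (P : set T) :
  open P -> open [set z | chart_img c z /\ P (chart_inv c z)].
Proof.
move=> oP; rewrite openE => z [cz Pz]; apply: filterI.
  by apply: open_nbhs_nbhs; split => //; exact: chart_img_open.
by apply: (chart_inv_cont cz); exact: open_nbhs_nbhs.
Qed.

Lemma smooth_continuous (M N : manifold) (f : M -> N) : smooth f -> continuous f.
Proof. by move=> [cf _] x; exact: cf. Qed.

Lemma smooth_id (M : manifold) : smooth (@id M).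
Proof.
split=> [x _|c d Ac Ad k]; first exact: cvg_id.
apply: Ck_local => z [cz _ dz].
exists [set z | chart_img c z /\ chart_dom d (chart_inv c z)] => //.
exact: (atlas_compat Ac Ad k).
Qed.

Lemma smooth_comp (M N P : manifold) (f : M -> N) (g : N -> P) :
  smooth g -> smooth f -> smooth (g \o f).
Proof.
move=> Sg Sf; have cg := smooth_continuous Sg; have cf := smooth_continuous Sf.
have cgf : continuous (g \o f) by move=> x; apply: continuous_comp; [exact: cf|exact: cg].
split=> [x _|c d Ac Ad k]; first exact: cgf.
apply: Ck_local => z [cz _ dz].
have [e Ae ez] := atlas_cover (f (chart_inv c z)).
pose S := [set z | chart_img c z /\
  ((f @^-1` chart_dom e) `&` ((g \o f) @^-1` chart_dom d)) (chart_inv c z)].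
have oS : open S.
  by apply: chart_open; apply: openI; apply: (open_comp _ (chart_dom_open _)) => y _.
exists S => //.
pose S' := [set w | chart_img e w /\ (g @^-1` chart_dom d) (chart_inv e w)].
have oS' : open S'.
  by apply: chart_open; apply: (open_comp _ (chart_dom_open _)) => y _.
apply: (Ck_ext (f := (chart_fun d \o g \o chart_inv e) \o
                     (chart_fun e \o f \o chart_inv c))) => //.
  by move=> w [_ [ew _]] /=; rewrite chart_funK.
apply: (@Ck_comp _ _ _ _ _ _ S') => //.
- by move=> w [cw [ew dw]]; split; [exact: chart_funP|rewrite /= chart_funK].
- have := Sf.2 c e Ac Ae k; move=> H; apply: Ck_local => w [cw [ew _]].
  by eexists; [|exact: H].
- have := Sg.2 e d Ae Ad k; move=> H; apply: Ck_local => w [ew dw].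
  by eexists; [|exact: H].
Qed.

(* The tangent space at [x] is presented in the coordinates of a chosen chart
   around [x]. *)
Definition chart_at (M : manifold) (x : M) : chart M (mfd_dim M) :=
  s2val (cid2 (atlas_cover x)).

Definition tangent (M : manifold) (x : M) : normedModType R := 'rV[R]_(mfd_dim M).

Definition tangent_map (M N : manifold) (f : M -> N) (x : M) :
    tangent x -> tangent (f x) :=
  'd (chart_fun (chart_at (f x)) \o f \o chart_inv (chart_at x))
     (chart_fun (chart_at x) x).

Definition submersion (M N : manifold) (f : M -> N) : Prop :=
  smooth f /\ forall (x : M) (w : tangent (f x)), exists v, tangent_map f v = w.

Definition topological_embedding (S T : topologicalType) (f : S -> T) : Prop :=
  injective f /\ forall A, open A <-> exists2 B, open B & A = f @^-1` B.

Definition embedding (M N : manifold) (f : M -> N) : Prop :=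
  [/\ smooth f, topological_embedding f
    & forall x : M, injective (@tangent_map M N f x)].

(* [P], with projections [p1] and [p2], is the submanifold
   {(x, y) | f x = g y} of the product manifold M x N.  The last condition says
   that the inclusion (p1, p2) is an immersion, using the identification
   T(M x N) = TM x TN. *)
Definition fibre_product (M N B : manifold) (f : M -> B) (g : N -> B)
    (P : manifold) (p1 : P -> M) (p2 : P -> N) : Prop :=
  [/\ smooth p1, smooth p2,
      topological_embedding (fun p => (p1 p, p2 p) : M * N),
      range (fun p => (p1 p, p2 p)) = [set xy | f xy.1 = g xy.2]
    & forall (p : P) (v : tangent p),
        tangent_map p1 v = 0 -> tangent_map p2 v = 0 -> v = 0].

End Manifolds.
Arguments manifold : clear implicits.

(** * Lie groupoids *)

Section LieGroupoids.
Context {R : realType}.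

(* [mul h g] is the product hg, first [g] then [h]; it is constrained only for
   [src h = tgt g]. *)
Record lie_groupoid := LieGroupoid {
  base : manifold R;
  arrow : manifold R;
  src : arrow -> base;
  tgt : arrow -> base;
  id_arrow : base -> arrow;
  mul : arrow -> arrow -> arrow;
  inv : arrow -> arrow;
  src_id : forall x, src (id_arrow x) = x;
  tgt_id : forall x, tgt (id_arrow x) = x;
  src_mul : forall h g, src h = tgt g -> src (mul h g) = src g;
  tgt_mul : forall h g, src h = tgt g -> tgt (mul h g) = tgt h;
  mulA : forall k h g, src k = tgt h -> src h = tgt g ->
    mul k (mul h g) = mul (mul k h) g;
  mul1g : forall g, mul (id_arrow (tgt g)) g = g;
  mulg1 : forall g, mul g (id_arrow (src g)) = g;
  src_inv : forall g, src (inv g) = tgt g;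
  tgt_inv : forall g, tgt (inv g) = src g;
  mulVg : forall g, mul (inv g) g = id_arrow (src g);
  mulgV : forall g, mul g (inv g) = id_arrow (tgt g);
  src_submersion : submersion src;
  tgt_submersion : submersion tgt;
  id_smooth : smooth id_arrow;
  inv_smooth : smooth inv;
  mul_smooth : exists (P : manifold R) (p1 p2 : P -> arrow),
    fibre_product src tgt p1 p2 /\ smooth (fun p => mul (p1 p) (p2 p))
}.

Record lie_hom (G H : lie_groupoid) := LieHom {
  hom_base : base G -> base H;
  hom_arrow : arrow G -> arrow H;
  hom_base_smooth : smooth hom_base;
  hom_arrow_smooth : smooth hom_arrow;
  hom_src : forall g, src (hom_arrow g) = hom_base (src g);
  hom_tgt : forall g, tgt (hom_arrow g) = hom_base (tgt g);
  hom_id : forall x, hom_arrow (id_arrow x) = id_arrow (hom_base x);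
  hom_mul : forall h g, src h = tgt g ->
    hom_arrow (mul h g) = mul (hom_arrow h) (hom_arrow g)
}.

Definition lie_hom_id (G : lie_groupoid) : lie_hom G G.
Proof. by exists id id => //; exact: smooth_id. Defined.

Definition lie_hom_comp (G H K : lie_groupoid) (psi : lie_hom H K)
  (phi : lie_hom G H) : lie_hom G K.
Proof.
exists (hom_base psi \o hom_base phi) (hom_arrow psi \o hom_arrow phi) => /=.
- by apply: smooth_comp; exact: hom_base_smooth.
- by apply: smooth_comp; exact: hom_arrow_smooth.
- by move=> g; rewrite !hom_src.
- by move=> g; rewrite !hom_tgt.
- by move=> x; rewrite !hom_id.
- by move=> h g hg; rewrite !hom_mul// hom_src hom_tgt hg.
Defined.

(** ** Orbit spaces *)

Definition orbit_rel (G : lie_groupoid) : rel (base G) :=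
  fun x y => `[< exists g : arrow G, src g = x /\ tgt g = y >].

Lemma orbit_equiv (G : lie_groupoid) : equiv_class_of (@orbit_rel G).
Proof.
split.
- by move=> x; apply/asboolP; exists (id_arrow x); rewrite src_id tgt_id.
- by apply: symmetric_from_pre => x y /asboolP[g [<- <-]]; apply/asboolP;
    exists (inv g); rewrite src_inv tgt_inv.
- move=> y x z /asboolP[g [gx gy]] /asboolP[h [hy hz]]; apply/asboolP.
  by exists (mul h g); rewrite src_mul ?tgt_mul ?hy ?gy.
Qed.

Definition orbit_equiv_rel (G : lie_groupoid) : equiv_rel (base G) :=
  EquivRelPack (orbit_equiv G).

Definition orbit_space (G : lie_groupoid) : topologicalType :=
  quotient_topology {eq_quot (orbit_equiv_rel G)}.

Definition orbit_class (G : lie_groupoid) (x : base G) : orbit_space G :=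
  (\pi_({eq_quot (orbit_equiv_rel G)}) x).

Definition orbit_map (G H : lie_groupoid) (phi : lie_hom G H) :
    orbit_space G -> orbit_space H :=
  fun q => orbit_class (hom_base phi (repr q)).

Lemma orbit_mapE (G H : lie_groupoid) (phi : lie_hom G H) (x : base G) :
  orbit_map phi (orbit_class x) = orbit_class (hom_base phi x).
Proof.
apply/eqmodP/asboolP.
have /eqmodP/asboolP[g [gx gy]] :
    (orbit_class (repr (orbit_class x)) = orbit_class x) by exact: reprK.
by exists (hom_arrow phi g); rewrite hom_src hom_tgt gx gy.
Qed.

(** ** Ineffective isotropy *)

(* The orbit O_x: [fib] is the source fibre G^x, as a submanifold of the
   manifold of arrows, [orb_proj] is its quotient by the right action of the
   isotropy group at x, and [orb_incl] is induced by the target map. *)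
Record orbit_manifold (G : lie_groupoid) (x : base G) := OrbitManifold {
  fib : manifold R;
  fib_incl : fib -> arrow G;
  fib_embedding : embedding fib_incl;
  fib_range : range fib_incl = [set g | src g = x];
  orb : manifold R;
  orb_proj : fib -> orb;
  orb_proj_submersion : submersion orb_proj;
  orb_proj_surj : range orb_proj = setT;
  orb_proj_eq : forall p q, orb_proj p = orb_proj q <->
    exists k, [/\ src k = x, tgt k = x & fib_incl q = mul (fib_incl p) k];
  orb_incl : orb -> base G;
  orb_inclE : forall p, orb_incl (orb_proj p) = tgt (fib_incl p)
}.

(* [orbit_manifold x] is inhabited, uniquely up to diffeomorphism, so the
   choice of [O] is immaterial. *)
Definition longitudinal (G : lie_groupoid) (x : base G) : set (tangent x) :=
  [set v | exists (O : orbit_manifold x) (p : fib O)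
             (u : tangent (orb_proj p)),
           fib_incl p = id_arrow x /\ tangent_map (@orb_incl _ _ O) u = v].

(* An element of N_x = T_x / L_x, as a coset of L_x *)
Definition transversal_class (G : lie_groupoid) (x : base G) (v : tangent x) :
    set (tangent x) :=
  [set w | longitudinal (w - v)].

Definition local_section (G : lie_groupoid) (g : arrow G)
    (sec : base G -> arrow G) : Prop :=
  sec (src g) = g /\
  exists U : set (base G), [/\ open U, U (src g), smooth_on U sec
    & forall y, U y -> src (sec y) = y].

(* The map induced on cosets by the tangent map of [tgt \o sec], for a local
   section [sec] through [g] *)
Definition effect (G : lie_groupoid) (g : arrow G)
    (C : set (tangent (src g))) : set (tangent (tgt g)) :=
  [set w | exists sec (v : tangent (src g)),
     [/\ local_section g sec, C v
       & @longitudinal G (tgt g) (w - tangent_map (@tgt G \o sec) v)]].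

Definition ineffective (G : lie_groupoid) (x : base G) (g : arrow G) : Prop :=
  [/\ src g = x, tgt g = x
    & forall v : tangent x,
        @effect G g (transversal_class v) = transversal_class v].

Definition congruent (G : lie_groupoid) (h1 h2 : arrow G) : Prop :=
  [/\ src h1 = src h2, tgt h1 = tgt h2
    & ineffective (src h1) (mul (inv h2) h1)].

Definition natural_congruence (G H : lie_groupoid) (phi psi : lie_hom G H)
    (tau : base G -> arrow H) : Prop :=
  [/\ smooth tau,
      forall x, src (tau x) = hom_base phi x /\ tgt (tau x) = hom_base psi x
    & forall g, congruent (mul (tau (tgt g)) (hom_arrow phi g))
                          (mul (hom_arrow psi g) (tau (src g)))].

(** ** Full, completely transversal homomorphisms *)

Definition full (G H : lie_groupoid) (phi : lie_hom G H) : Prop :=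
  forall (x x' : base G) (h : arrow H),
    src h = hom_base phi x -> tgt h = hom_base phi x' ->
    exists g, [/\ src g = x, tgt g = x' & hom_arrow phi g = h].

(* The fibre product exists, and is unique up to diffeomorphism, because
   [@tgt H] is a submersion. *)
Definition completely_transversal (G H : lie_groupoid) (phi : lie_hom G H) :
    Prop :=
  exists (P : manifold R) (p1 : P -> base G) (p2 : P -> arrow H),
    [/\ fibre_product (hom_base phi) (@tgt H) p1 p2,
        submersion (@src H \o p2) & range (@src H \o p2) = setT].

End LieGroupoids.
Arguments lie_groupoid : clear implicits.

(** * Categories, quotient categories and localizations *)

(* Equality of morphisms is an equivalence relation [cat_eq], so that quotients
   and localizations only change this relation and the morphisms. *)
Record category := Category {
  cat_obj :> Type;
  cat_hom : cat_obj -> cat_obj -> Type;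
  cat_eq : forall a b, cat_hom a b -> cat_hom a b -> Prop;
  cat_id : forall a, cat_hom a a;
  cat_comp : forall a b c, cat_hom b c -> cat_hom a b -> cat_hom a c;
  cat_eq_refl : forall a b (f : cat_hom a b), cat_eq f f;
  cat_eq_sym : forall a b (f g : cat_hom a b), cat_eq f g -> cat_eq g f;
  cat_eq_trans : forall a b (f g h : cat_hom a b),
    cat_eq f g -> cat_eq g h -> cat_eq f h;
  cat_comp_eq : forall a b c (g g' : cat_hom b c) (f f' : cat_hom a b),
    cat_eq g g' -> cat_eq f f' -> cat_eq (cat_comp g f) (cat_comp g' f');
  cat_compA : forall a b c d (h : cat_hom c d) (g : cat_hom b c)
    (f : cat_hom a b),
    cat_eq (cat_comp h (cat_comp g f)) (cat_comp (cat_comp h g) f);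
  cat_comp1 : forall a b (f : cat_hom a b), cat_eq (cat_comp f (cat_id a)) f;
  cat_1comp : forall a b (f : cat_hom a b), cat_eq (cat_comp (cat_id b) f) f
}.
Arguments cat_id {c0} a.

Definition is_iso (C : category) (a b : C) (f : cat_hom a b) : Prop :=
  exists g : cat_hom b a,
    cat_eq (cat_comp g f) (cat_id a) /\ cat_eq (cat_comp f g) (cat_id b).

Definition hom_class (C : category) := forall a b : C, cat_hom a b -> Prop.
Definition hom_rel (C : category) :=
  forall a b : C, cat_hom a b -> cat_hom a b -> Prop.

(* The least congruence on [C] containing [r] *)
Inductive quot_eq (C : category) (r : hom_rel C) :
    forall a b : C, cat_hom a b -> cat_hom a b -> Prop :=
| quot_eq_base a b (f g : cat_hom a b) : cat_eq f g -> quot_eq r f g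
| quot_eq_rel a b (f g : cat_hom a b) : r a b f g -> quot_eq r f g
| quot_eq_sym a b (f g : cat_hom a b) : quot_eq r f g -> quot_eq r g f
| quot_eq_trans a b (f g h : cat_hom a b) :
    quot_eq r f g -> quot_eq r g h -> quot_eq r f h
| quot_eq_comp a b c (g g' : cat_hom b c) (f f' : cat_hom a b) :
    quot_eq r g g' -> quot_eq r f f' ->
    quot_eq r (cat_comp g f) (cat_comp g' f').

Definition quotient_category (C : category) (r : hom_rel C) : category.
Proof.
apply: (@Category C (@cat_hom C) (@quot_eq C r) (@cat_id C) (@cat_comp C)).
- by move=> a b f; apply: quot_eq_base; exact: cat_eq_refl.
- exact: quot_eq_sym.
- exact: quot_eq_trans.
- exact: quot_eq_comp.
- by move=> *; apply: quot_eq_base; exact: cat_compA.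
- by move=> *; apply: quot_eq_base; exact: cat_comp1.
- by move=> *; apply: quot_eq_base; exact: cat_1comp.
Defined.

(* The image of a class of morphisms in the quotient *)
Definition quotient_class (C : category) (r : hom_rel C) (W : hom_class C) :
    hom_class (quotient_category r) :=
  fun a b f => exists2 w, W a b w & quot_eq r f w.

(* The localization of [C] at [W]: its morphisms are the formal composites of
   morphisms of [C] and of formal inverses of elements of [W]. *)
Inductive loc_hom (C : category) (W : hom_class C) : C -> C -> Type :=
| loc_of a b : cat_hom a b -> loc_hom W a b
| loc_inv a b (w : cat_hom a b) : W a b w -> loc_hom W b a
| loc_comp a b c : loc_hom W b c -> loc_hom W a b -> loc_hom W a c.

Inductive loc_eq (C : category) (W : hom_class C) :
    forall a b : C, loc_hom W a b -> loc_hom W a b -> Prop :=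
| loc_eq_refl a b (f : loc_hom W a b) : loc_eq f f
| loc_eq_sym a b (f g : loc_hom W a b) : loc_eq f g -> loc_eq g f
| loc_eq_trans a b (f g h : loc_hom W a b) :
    loc_eq f g -> loc_eq g h -> loc_eq f h
| loc_eq_comp a b c (g g' : loc_hom W b c) (f f' : loc_hom W a b) :
    loc_eq g g' -> loc_eq f f' -> loc_eq (loc_comp g f) (loc_comp g' f')
| loc_eqA a b c d (h : loc_hom W c d) (g : loc_hom W b c) (f : loc_hom W a b) :
    loc_eq (loc_comp h (loc_comp g f)) (loc_comp (loc_comp h g) f)
| loc_eq_comp1 a b (f : loc_hom W a b) :
    loc_eq (loc_comp f (loc_of W (cat_id a))) f
| loc_eq_1comp a b (f : loc_hom W a b) :
    loc_eq (loc_comp (loc_of W (cat_id b)) f) f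
| loc_eq_of a b (f g : cat_hom a b) :
    cat_eq f g -> loc_eq (loc_of W f) (loc_of W g)
| loc_eq_of_comp a b c (g : cat_hom b c) (f : cat_hom a b) :
    loc_eq (loc_of W (cat_comp g f)) (loc_comp (loc_of W g) (loc_of W f))
| loc_eq_invl a b (w : cat_hom a b) (Ww : W a b w) :
    loc_eq (loc_comp (loc_inv Ww) (loc_of W w)) (loc_of W (cat_id a))
| loc_eq_invr a b (w : cat_hom a b) (Ww : W a b w) :
    loc_eq (loc_comp (loc_of W w) (loc_inv Ww)) (loc_of W (cat_id b)).

Definition localization (C : category) (W : hom_class C) : category :=
  @Category C (loc_hom W) (@loc_eq C W) (fun a => loc_of W (cat_id a))
    (@loc_comp C W) (@loc_eq_refl C W) (@loc_eq_sym C W) (@loc_eq_trans C W)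
    (@loc_eq_comp C W) (@loc_eqA C W) (@loc_eq_comp1 C W) (@loc_eq_1comp C W).

(** * Effective equivalences *)

Section EffectiveEquivalences.
Variable R : realType.

Record lgpd_hom (G H : lie_groupoid R) := LgpdHom {
  lgpd_lie_hom :> lie_hom G H;
  lgpd_ineffective : forall x g, ineffective x g ->
    ineffective (hom_base lgpd_lie_hom x) (hom_arrow lgpd_lie_hom g)
}.

Definition lgpd_hom_id (G : lie_groupoid R) : lgpd_hom G G.
Proof. by exists (lie_hom_id G). Defined.

Definition lgpd_hom_comp (G H K : lie_groupoid R) (psi : lgpd_hom H K)
  (phi : lgpd_hom G H) : lgpd_hom G K.
Proof.
exists (lie_hom_comp psi phi) => x g gx.
by apply: lgpd_ineffective; exact: lgpd_ineffective.
Defined.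

Definition lgpd_eq (G H : lie_groupoid R) (phi psi : lgpd_hom G H) : Prop :=
  hom_base phi = hom_base psi /\ hom_arrow phi = hom_arrow psi.

Definition LGpd : category.
Proof.
apply: (@Category (lie_groupoid R) lgpd_hom lgpd_eq lgpd_hom_id lgpd_hom_comp).
- by [].
- by move=> G H phi psi [E1 E2]; split.
- by move=> G H phi psi chi [E1 E2] [E3 E4]; split; [rewrite E1|rewrite E2].
- by move=> G H K psi psi' phi phi' [E1 E2] [E3 E4]; split => /=;
    rewrite ?E1 ?E2 ?E3 ?E4.
- by [].
- by [].
- by [].
Defined.

Definition naturally_congruent : hom_rel LGpd :=
  fun G H (phi psi : lgpd_hom G H) => exists tau, natural_congruence phi psi tau.

(* [naturally_congruent] is itself a congruence, so that the congruence which
   it generates identifies exactly the naturally congruent homomorphisms. *)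
Definition LGpd_quotient : category := quotient_category naturally_congruent.

Definition full_completely_transversal : hom_class LGpd :=
  fun G H (phi : lgpd_hom G H) => full phi /\ completely_transversal phi.

Definition LGpd_localized : category :=
  @localization LGpd_quotient
    (quotient_class (r := naturally_congruent) full_completely_transversal).

Definition to_localized (G H : lie_groupoid R) (phi : lgpd_hom G H) :
    @cat_hom LGpd_localized G H :=
  @loc_of LGpd_quotient _ G H phi.

Definition effective_equivalence (G H : lie_groupoid R) (phi : lgpd_hom G H) :
    Prop :=
  is_iso (to_localized phi).

End EffectiveEquivalences.

Definition homeomorphism (S T : topologicalType) (f : S -> T) : Prop :=
  continuous f /\ exists g, [/\ continuous g, cancel f g & cancel g f].

(* Main.v *)
From HB Require Import structures.
Require Import Defs.
From mathcomp Require Import all_boot all_order all_algebra.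
From mathcomp Require Import all_classical all_reals all_analysis.

Set Implicit Arguments.
Unset Strict Implicit.
Unset Printing Implicit Defensive.
Import Order.TTheory GRing.Theory Num.Theory.
Import numFieldNormedType.Exports.
Local Open Scope classical_set_scope.
Local Open Scope ring_scope.

(** Passing to orbit spaces is a functor from Lie groupoids to topological
    spaces.  It identifies naturally congruent homomorphisms, since the value
    at [x] of a natural congruence is an arrow joining the two images of [x].
    It also sends full, completely transversal homomorphisms to
    homeomorphisms ([orbit_map_homeomorphism]).  Therefore it extends to the
    localization ([localized_orbit_map], [localized_orbit_map_eq]), where the
    inverse of an effective equivalence yields a continuous inverse of the
    map that it induces.

    For a full, completely transversal [phi], fullness gives injectivity on
    orbits, and surjectivity of (x, h) |-> s(h) gives surjectivity.  The
    inverse is continuous because the induced map is open: the saturated set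
    of base points whose class lies in the image of an open set is the image
    of an open subset of the fibre product under (x, h) |-> s(h), and
    submersions are open maps ([submersion_open]).

    Openness of submersions is a local statement in charts
    ([local_surjection]).  After composition with an affine right inverse of
    the derivative at the point, the map has the form id - f with f of zero
    derivative, hence f is Lipschitz of constant 1/2 near the point; the
    equation u - f u = y is then solved by the fixed point theorem of
    Banach. *)

(** * Local surjectivity of maps with surjective derivative *)

(** Matrix spaces are complete uniform spaces and normed modules; this joins
    the two structures, as the fixed point theorem requires. *)
HB.instance Definition _ (R : realType) m n :=
  Uniform_isComplete.Build 'M[R]_(m, n) cauchy_cvg.

Section LocalSurjectivity.
Context {R : realType}.

Lemma mx_norm_le m n (A : 'M[R]_(m, n)) (e : R) : 0 <= e ->
  (forall i j, `|A i j| <= e) -> `|A| <= e.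
Proof.
move=> e0 Ae; rewrite [`|A|]mx_normrE.
by apply: bigmax_le => // -[i j] _; exact: Ae.
Qed.

Lemma coord_le_mx_norm m n (A : 'M[R]_(m, n)) i j : `|A i j| <= `|A|.
Proof.
rewrite [`|A|]mx_normrE.
exact: (le_bigmax _ (fun ij => `|A ij.1 ij.2|) (i, j)).
Qed.

(** Mean value inequality: each coordinate of [f] is differentiated along the
    segment from [v] to [u], and the derivative in the direction [u - v] is the
    combination of the [m] partial derivatives with coefficients at most
    [`|u - v|] in absolute value. *)
Lemma small_partials_lipschitz m n (f : 'rV[R]_m -> 'rV[R]_n) (r e : R) :
  0 <= e ->
  (forall u, `|u| <= r -> differentiable f u) ->
  (forall j u, `|u| <= r -> `|'D_(delta_mx 0 j) f u| <= e) ->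
  forall u v, `|u| <= r -> `|v| <= r -> `|f u - f v| <= e *+ m * `|u - v|.
Proof.
move=> e0 df De u v ur vr.
pose p t := v + t *: (u - v).
have pr (t : R) : t \in `[0, 1]%R -> `|p t| <= r.
  rewrite in_itv /= => /andP[t0 t1].
  have -> : p t = (1 - t) *: v + t *: u.
    by rewrite /p scalerBr scalerBl scale1r -!addrA [- _ + _]addrC.
  rewrite (le_trans (ler_normD _ _))// !normrZ !ger0_norm ?subr_ge0//.
  have -> : r = (1 - t) * r + t * r by rewrite -mulrDl subrK mul1r.
  by rewrite lerD// ler_wpM2l// subr_ge0.
have bound w : `|w| <= r -> `|'d f w (u - v)| <= e *+ m * `|u - v|.
  move=> wr; rewrite [X in 'd f w X]row_sum_delta linear_sum /=.
  rewrite (le_trans (ler_norm_sum _ _ _))//.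
  rewrite mulrnAl -[X in _ *+ X]card_ord -sumr_const ler_sum// => j _.
  rewrite linearZ /= normrZ mulrC ler_pM//; last exact: coord_le_mx_norm.
  by rewrite -deriveE; [exact: De|exact: df].
apply: mx_norm_le => [|i j]; first by rewrite mulr_ge0// mulrn_wge0.
have dp (t : R) : is_diff t p ( *:%R ^~ (u - v)).
  by apply: is_diff_eq; rewrite add0r.
have dg (t : R) : t \in `[0, 1]%R ->
    is_derive t (1 : R) (fun t => f (p t) i j) (('d f (p t) (u - v)) i j).
  move=> t01; have dfp : differentiable (f \o p) t.
    by apply: differentiable_comp => //; exact/df/pr.
  apply: DeriveDef.
    apply: diff_derivable.
    by apply: (@differentiable_comp _ _ _ _ (f \o p)
      (fun M : 'rV[R]_n => M i j : R^o)); last exact: differentiable_coord.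
  have E := derive_mx (diff_derivable (v := 1 : R) dfp).
  have E1 : 'D_1 (fun t => f (p t) i j) t = ('D_1 (f \o p) t) i j.
    by rewrite E mxE.
  rewrite E1.
  rewrite (deriveE _ dfp).
  rewrite (diff_comp _ (df _ (pr _ t01))) //.
  by rewrite /= diff_val scale1r.
pose g (t : R) : R := f (p t) i j.
pose g' (t : R) : R := ('d f (p t) (u - v)) i j.
have cg : {within `[0, 1], continuous g}.
  by apply: derivable_within_continuous => t t01; have [] := dg t t01.
have dg' (t : R) : t \in `]0, 1[%R -> is_derive t (1 : R) g (g' t).
  by move=> t01; apply: dg; exact: subset_itv_oo_cc.
have [c c01] := MVT_segment ler01 dg' cg.
rewrite /g /g' {g g' cg dg' dg}.
rewrite subr0 mulr1 /p scale1r scale0r addr0 addrCA subrr addr0 !mxE => ->.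
exact: le_trans (coord_le_mx_norm _ _ _) (bound _ (pr _ c01)).
Qed.

Lemma CkB (V W : normedModType R) k (A : set V) (f g : V -> W) :
  open A -> Ck k A f -> Ck k A g -> Ck k A (fun x => f x - g x).
Proof.
move=> oA; elim: k f g => [|k IH] f g /=.
  by move=> cf cg x Ax; apply: cvgB; [exact: cf|exact: cg].
move=> [df Df] [dg Dg]; split=> [x Ax|v].
  by apply: (@differentiableB _ _ _ f g); [exact: df|exact: dg].
apply: (Ck_ext oA _ (IH _ _ (Df v) (Dg v))) => x Ax.
by rewrite -deriveB//; apply: diff_derivable; [exact: df|exact: dg].
Qed.

Lemma Ck_linear m n k (S : set 'rV[R]_m) (A : 'M[R]_(m, n)) :
  open S -> Ck k S (mulmxr A : 'rV[R]_m -> 'rV[R]_n).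
Proof.
move=> oS.
have dA x : differentiable (mulmxr A : 'rV[R]_m -> 'rV[R]_n) x.
  have -> : (mulmxr A : 'rV[R]_m -> 'rV[R]_n) =
      \sum_j (fun u : 'rV[R]_m => u 0 j *: row j A).
    by apply/funext => u; rewrite fct_sumE /= mulmx_sum_row.
  apply: differentiable_sum => j; apply: differentiableZl.
  exact: differentiable_coord.
case: k => [|k] /=; first by move=> x _; exact: differentiable_continuous.
split=> // v.
have -> : 'D_v (mulmxr A : 'rV[R]_m -> 'rV[R]_n) = fun=> v *m A;
  last exact: Ck_cst.
apply/funext => x; rewrite deriveE // diff_lin // => y.
exact: differentiable_continuous.
Qed.

Lemma derive_linear m n (A : 'M[R]_(m, n)) v x :
  'D_v (mulmxr A : 'rV[R]_m -> 'rV[R]_n) x = v *m A.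
Proof.
have [dA _] := @Ck_linear m n 1 setT A openT.
rewrite deriveE ?diff_lin //; last exact: dA.
by move=> y; apply: differentiable_continuous; exact: dA.
Qed.

(** Continuity of the partial derivatives makes them uniformly small on a ball
    around [0]. *)
Lemma null_derivative_lipschitz m n (f : 'rV[R]_m -> 'rV[R]_n)
    (S : set 'rV[R]_m) :
  open S -> S 0 -> Ck 1 S f -> (forall v, 'D_v f 0 = 0) ->
  exists2 r : R, 0 < r & forall u v, `|u| <= r -> `|v| <= r ->
    [/\ S u, S v & `|f u - f v| <= 2^-1 * `|u - v|].
Proof.
move=> oS S0 [df Df] Df0.
(* with this bound, the sum of [m] partial derivatives is at most 1/2 *)
pose e : R := (2 * m.+1%:R)^-1.
have e0 : 0 < e by rewrite invr_gt0 mulr_gt0 // ltr0n.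
have : \forall u \near (0 : 'rV[R]_m),
    S u /\ forall j, `|'D_(delta_mx 0 j) f u| <= e.
  apply: filterI; first exact: open_nbhs_nbhs.
  have near_j j : \forall u \near (0 : 'rV[R]_m), `|'D_(delta_mx 0 j) f u| <= e.
    have := Df (delta_mx 0 j) _ S0; rewrite /prop_for /continuous_at Df0.
    by move=> /cvgr0_norm_le; exact.
  exact: (filter_forall _ near_j).
move=> /nbhs_closedballP[r Sr]; exists r%:num => // u v ur vr.
have bS w : `|w| <= r%:num -> S w /\ forall j, `|'D_(delta_mx 0 j) f w| <= e.
  move=> wr; apply: Sr.
  by rewrite closed_ballE // /closed_ball_ /= sub0r normrN.
split; [exact: (bS _ ur).1|exact: (bS _ vr).1|].
apply: (le_trans
  (@small_partials_lipschitz _ _ f r%:num e (ltW e0) _ _ u v ur vr)).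
- by move=> w /bS[Sw _]; exact: df.
- by move=> j w /bS[_].
rewrite ler_wpM2r // /e invfM -mulrnAr ler_piMr // -mulr_natr.
by rewrite ler_pdivrMl ?ltr0n// mulr1 ler_nat.
Qed.

(** The solution is the fixed point of [u |-> f u + y], which contracts the
    closed ball of radius [r]. *)
Lemma lipschitz_perturbation_onto n (f : 'rV[R]_n -> 'rV[R]_n) (r : R) :
  0 < r ->
  (forall u v, `|u| <= r -> `|v| <= r -> `|f u - f v| <= 2^-1 * `|u - v|) ->
  forall y, `|y + f 0| <= r / 2 -> exists2 u, `|u| <= r & u - f u = y.
Proof.
move=> r0 fl y yr.
pose U := [set u : 'rV[R]_n | `|u| <= r].
pose g u := f u + y.
have gU : set_fun U U g.
  move=> u /= ur; have -> : g u = (f u - f 0) + (y + f 0).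
    by rewrite /g addrACA [- _ + _]addrC addrA addrK.
  rewrite /U /= (le_trans (ler_normD _ _))// (splitr r) lerD //.
  rewrite (le_trans (fl _ _ ur _)) ?normr0 ?(ltW r0) // subr0 mulrC.
  by rewrite ler_wpM2r.
pose gg : {fun U >-> U} := HB.pack g (isFun.Build _ _ _ _ g gU).
have ctr : is_contraction gg.
  exists (2^-1)%:nng; split; first by rewrite /= invf_lt1 // ltr1n.
  move=> [u v] [/= Uu Uv]; rewrite /g opprD addrACA subrr addr0.
  exact: fl.
have clU : closed U.
  have -> : U = closed_ball_ Num.Def.normr 0 r.
    by apply/funext => u; rewrite /U /closed_ball_ /= sub0r normrN.
  exact: closed_closed_ball_.
have [|u Uu ug] := banach_fixed_point ctr clU.
  by exists 0; rewrite /U /= normr0 ltW.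
by exists u => //; rewrite {1}ug /= /g addrC addKr.
Qed.

(** It suffices to restrict [F] to the points [x + u *m A], where [A] is a
    right inverse of the derivative of [F] at [x]; this restriction has
    derivative the identity at [u = 0]. *)
Lemma local_surjection n m (F : 'rV[R]_n -> 'rV[R]_m) (S : set 'rV[R]_n) x :
  open S -> S x -> Ck 1 S F -> (forall w, exists v, 'd F x v = w) ->
  nbhs (F x) (F @` S).
Proof.
move=> oS Sx CF dsurj.
pose A := \matrix_i sval (cid (dsurj (delta_mx 0 i))).
have dA w : 'd F x (w *m A) = w.
  rewrite mulmx_sum_row linear_sum [RHS]row_sum_delta; apply: eq_bigr => j _.
  by rewrite linearZ /= rowK; case: cid => v /= ->.
pose L (u : 'rV[R]_m) := x + u *m A.
have CL (B : set 'rV[R]_m) : open B -> Ck 1 B L.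
  by move=> oB; apply: CkD => //; [exact: Ck_cst|exact: Ck_linear].
pose T := L @^-1` S.
have oT : open T.
  apply: open_comp => // u _; apply: (differentiable_continuous).
  exact: (CL setT openT).1.
have T0 : T 0 by rewrite /T /L /= mul0mx addr0.
pose f u := u - F (L u).
have CFL : Ck 1 T (F \o L) by apply: (Ck_comp oT oS) => //; exact: CL.
have Cf : Ck 1 T f.
  apply: (@CkB _ _ 1 T id (F \o L) oT _ CFL).
  have -> : id = mulmxr 1%:M :> ('rV[R]_m -> 'rV[R]_m).
    by apply/funext => u /=; rewrite mulmx1.
  exact: Ck_linear.
have Df0 v : 'D_v f 0 = 0.
  have dL : differentiable L 0 by exact: (CL setT openT).1.
  have dFL : differentiable (F \o L) 0 by apply: CFL.1.
  have dF : differentiable F (L 0) by apply: CF.1.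
  rewrite (@deriveB _ _ _ id (F \o L)) //; last exact: diff_derivable.
  rewrite derive_id (deriveE _ dFL) diff_comp // /= -(deriveE _ dL).
  have -> : 'D_v L 0 = v *m A.
    rewrite (@deriveD _ _ _ (cst x) (mulmxr A)) //.
      by rewrite derive_cst add0r derive_linear.
    apply: diff_derivable; exact: (@Ck_linear _ _ 1 setT _ openT).1.
  by rewrite /L mul0mx addr0 dA subrr.
have [r r0 fr] := null_derivative_lipschitz oT T0 Cf Df0.
have f0 : f 0 = - F x by rewrite /f /L mul0mx addr0 sub0r.
apply/nbhs_ballP; exists (r / 2); first by rewrite /= divr_gt0.
move=> y; rewrite -ball_normE /= => yr.
have [||u ur <-] := @lipschitz_perturbation_onto m f r r0 _ y.
- by move=> u v ur vr; have [] := fr u v ur vr.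
- by rewrite f0 distrC ltW.
exists (L u); first by have [] := fr u u ur ur.
by rewrite /f opprB addrC subrK.
Qed.

End LocalSurjectivity.

(** * Submersions are open *)

(** In the charts in which the tangent map is computed, this is
    [local_surjection]. *)
Lemma submersion_open (R : realType) (M N : manifold R) (f : M -> N)
    (U : set M) :
  submersion f -> open U -> open (f @` U).
Proof.
move=> [Sf df] oU; have cf := smooth_continuous Sf.
rewrite openE => _ [x Ux <-].
pose c := chart_at x; pose d := chart_at (f x).
have [Ac cx] : atlas c /\ chart_dom c x by rewrite /c /chart_at; case: cid2.
have [Ad dfx] : atlas d /\ chart_dom d (f x).
  by rewrite /d /chart_at; case: cid2.
pose S := [set z | chart_img c z /\
  (U `&` f @^-1` chart_dom d) (chart_inv c z)].
have oS : open S.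
  apply: chart_open; apply: openI => //.
  by apply: (open_comp _ (chart_dom_open _)) => y _; exact: cf.
pose F := chart_fun d \o f \o chart_inv c.
have CF : Ck 1 S F.
  apply: Ck_local => z [cz [_ dz]].
  by eexists; [|exact: (Sf.2 c d Ac Ad 1)]; split.
have Sx : S (chart_fun c x).
  by split; [exact: chart_funP|rewrite chart_funK].
have := local_surjection oS Sx CF (df x).
have -> : F (chart_fun c x) = chart_fun d (f x) by rewrite /F /= chart_funK.
move=> /(chart_fun_cont dfx) nFS'.
have nFS : nbhs (f x) (chart_fun d @^-1` (F @` S)) by exact: nFS'.
have nd : nbhs (f x) (chart_dom d).
  by apply: open_nbhs_nbhs; split => //; exact: chart_dom_open.
apply: (filterS _ (filterI nFS nd)) => y [[z [cz [Uz dz]] Fz] dy].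
by exists (chart_inv c z) => //; rewrite -(chart_funK dy) -Fz /F /= chart_funK.
Qed.

Lemma open_bijection_homeomorphism (S T : topologicalType) (f : S -> T) :
  continuous f -> injective f -> (forall y, exists x, f x = y) ->
  (forall U, open U -> open (f @` U)) -> homeomorphism f.
Proof.
move=> cf injf surjf openf; split=> //.
pose g y := sval (cid (surjf y)).
have fg y : f (g y) = y by rewrite /g; case: cid.
have gf x : g (f x) = x by apply: injf.
exists g; split=> //; apply/continuousP => U oU.
suff -> : g @^-1` U = f @` U by exact: openf.
by apply/seteqP; split=> [y Uy|_ [x Ux <-]]; [exists (g y)|rewrite /= gf].
Qed.

(** * Orbit spaces *)

Section OrbitSpaces.
Context {R : realType}.
Implicit Types G H K : lie_groupoid R.

Lemma orbit_class_eqP G (x y : base G) :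
  orbit_class x = orbit_class y <-> exists g : arrow G, src g = x /\ tgt g = y.
Proof. by split=> [/eqmodP/asboolP|E]; last exact/eqmodP/asboolP. Qed.

Lemma orbit_class_surj G (q : orbit_space G) : exists x, q = orbit_class x.
Proof. by exists (repr q); rewrite /orbit_class reprK. Qed.

Lemma orbit_class_continuous G : continuous (@orbit_class R G).
Proof. exact: pi_continuous. Qed.

Lemma orbit_map_continuous G H (phi : lie_hom G H) : continuous (orbit_map phi).
Proof.
apply/quotient_continuous.
rewrite (_ : _ \o _ = @orbit_class R H \o hom_base phi); last first.
  by apply/funext => x; exact: orbit_mapE.
move=> x; apply: continuous_comp; last exact: orbit_class_continuous.
exact: (smooth_continuous (hom_base_smooth phi)).
Qed.

Lemma orbit_map_full_inj G H (phi : lie_hom G H) :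
  full phi -> injective (orbit_map phi).
Proof.
move=> fphi q q'; have [x ->] := orbit_class_surj q.
have [x' ->] := orbit_class_surj q'.
rewrite !orbit_mapE => /orbit_class_eqP[h [hx hx']]; apply/orbit_class_eqP.
by have [g [gx gx' _]] := fphi _ _ _ hx hx'; exists g.
Qed.

(** The target of an arrow [h] starting at [y] with target in the image of the
    base map represents the orbit of [y]. *)
Lemma orbit_map_ct_surj G H (phi : lie_hom G H) (q : orbit_space H) :
  completely_transversal phi -> exists q', orbit_map phi q' = q.
Proof.
move=> [P [p1 [p2 [[_ _ _ rP _] _ sP]]]]; have [y ->] := orbit_class_surj q.
have [p _ <-] : range (@src R H \o p2) y by rewrite sP.
exists (orbit_class (p1 p)); rewrite orbit_mapE; apply/esym/orbit_class_eqP.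
exists (p2 p); split => //.
suff : [set xy | hom_base phi xy.1 = tgt xy.2] (p1 p, p2 p) by [].
by rewrite -rP; exists p.
Qed.

(** A base point [y] of [H] has its class in the image of [V] if and only if
    some arrow [h] starts at [y] and ends at the image of a point [x] with class
    in [V]; such pairs (x, h) form an open subset of the fibre product. *)
Lemma orbit_map_ct_open G H (phi : lie_hom G H) (V : set (orbit_space G)) :
  completely_transversal phi -> open V -> open (orbit_map phi @` V).
Proof.
move=> [P [p1 [p2 [[Sp1 _ _ rP _] sub _]]]] oV.
have rPE x h : hom_base phi x = tgt h <-> exists p, p1 p = x /\ p2 p = h.
  split=> [E|[p [<- <-]]].
    have : range (fun p => (p1 p, p2 p)) (x, h) by rewrite rP.
    by case=> p _ [<- <-]; exists p.
  suff : [set xy | hom_base phi xy.1 = tgt xy.2] (p1 p, p2 p) by [].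
  by rewrite -rP; exists p.
pose W := (@orbit_class R G \o p1) @^-1` V.
have oW : open W.
  apply: open_comp => // p _; apply: continuous_comp.
    exact: (smooth_continuous Sp1).
  exact: orbit_class_continuous.
suff E : @orbit_class R H @^-1` (orbit_map phi @` V) = (@src R H \o p2) @` W.
  change (open (@orbit_class R H @^-1` (orbit_map phi @` V))).
  by rewrite E; exact: submersion_open.
apply/seteqP; split=> y.
- move=> [q Vq]; have [x Ex] := orbit_class_surj q.
  rewrite Ex orbit_mapE => /esym/orbit_class_eqP[h [hy hx]].
  have [p [px ph]] := (rPE x h).1 (esym hx).
  by exists p; [rewrite /W /= px -Ex|rewrite /= ph].
- move=> [p Wp <-]; exists (orbit_class (p1 p)) => //.
  rewrite orbit_mapE; apply/esym/orbit_class_eqP; exists (p2 p); split=> //.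
  by apply/esym/rPE; exists p.
Qed.

Lemma orbit_map_homeomorphism G H (phi : lie_hom G H) :
  full phi -> completely_transversal phi -> homeomorphism (orbit_map phi).
Proof.
move=> fphi ct; apply: open_bijection_homeomorphism.
- exact: orbit_map_continuous.
- exact: orbit_map_full_inj.
- by move=> q; exact: orbit_map_ct_surj.
- by move=> U; exact: orbit_map_ct_open.
Qed.

(** * The orbit space functor on the localization *)

Lemma orbit_map_id G : orbit_map (lie_hom_id G) = id.
Proof.
by apply/funext => q; have [x ->] := orbit_class_surj q; rewrite orbit_mapE.
Qed.

Lemma orbit_map_comp G H K (psi : lie_hom H K) (phi : lie_hom G H) :
  orbit_map (lie_hom_comp psi phi) = orbit_map psi \o orbit_map phi.
Proof.
apply/funext => q; have [x ->] := orbit_class_surj q.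
by rewrite /= !orbit_mapE.
Qed.

Lemma natural_congruence_orbit_map G H (phi psi : lie_hom G H) tau :
  natural_congruence phi psi tau -> orbit_map phi = orbit_map psi.
Proof.
move=> [_ st _]; apply/funext => q; have [x ->] := orbit_class_surj q.
by rewrite !orbit_mapE; apply/orbit_class_eqP; exists (tau x).
Qed.

Lemma quot_eq_orbit_map (G H : LGpd R) (phi psi : cat_hom G H) :
  quot_eq (@naturally_congruent R) phi psi -> orbit_map phi = orbit_map psi.
Proof.
elim=> {G H phi psi}.
- move=> G H phi psi [E _]; apply/funext => q.
  have [x ->] := orbit_class_surj q.
  by rewrite !orbit_mapE E.
- by move=> G H phi psi [tau /natural_congruence_orbit_map].
- by [].
- by move=> G H phi psi chi _ -> _ ->.
- by move=> G H K psi psi' phi phi' _ E _ E'; rewrite /= !orbit_map_comp E E'.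
Qed.

Let W : hom_class (LGpd_quotient R) :=
  quotient_class (r := @naturally_congruent R) (@full_completely_transversal R).

Lemma inverted_homeomorphism (G H : LGpd_quotient R) (w : cat_hom G H) :
  W w -> homeomorphism (orbit_map w).
Proof.
move=> [v [fv cv] /quot_eq_orbit_map ->]; exact: orbit_map_homeomorphism.
Qed.

(** The map is defined on formal composites; the choice of inverses is
    immaterial, a bijection having only one, and by [localized_orbit_map_eq]
    only the class of the formal composite matters. *)
Fixpoint localized_orbit_map (G H : LGpd_quotient R) (f : loc_hom W G H) :
    orbit_space G -> orbit_space H :=
  match f with
  | loc_of _ _ phi => orbit_map phi
  | loc_inv _ _ w Ww => sval (cid (inverted_homeomorphism Ww).2)
  | loc_comp _ _ _ g f => localized_orbit_map g \o localized_orbit_map f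
  end.

Lemma localized_orbit_map_continuous (G H : LGpd_quotient R)
    (f : loc_hom W G H) :
  continuous (localized_orbit_map f).
Proof.
elim: f => {G H} [G H phi|G H w Ww|G H K g cg f cf] /=.
- exact: orbit_map_continuous.
- by case: cid => ? [].
- by move=> x; apply: continuous_comp; [exact: cf|exact: cg].
Qed.

Lemma localized_orbit_map_eq (G H : LGpd_quotient R) (f g : loc_hom W G H) :
  loc_eq f g -> localized_orbit_map f = localized_orbit_map g.
Proof.
elim=> {G H f g} //=.
- by move=> G H f g h _ -> _ ->.
- by move=> G H K g g' f f' _ -> _ ->.
- by move=> G H f; rewrite orbit_map_id.
- by move=> G H f; rewrite orbit_map_id.
- by move=> G H f g /quot_eq_orbit_map.
- by move=> G H K g f; rewrite orbit_map_comp.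
- move=> G H w Ww; rewrite orbit_map_id; case: cid => v [/= _ wK vK].
  by apply/funext => q /=; rewrite wK.
- move=> G H w Ww; rewrite orbit_map_id; case: cid => v [/= _ wK vK].
  by apply/funext => q /=; rewrite vK.
Qed.

End OrbitSpaces.

Theorem mainTheorem2 (R : realType) (G H : lie_groupoid R) (phi : lgpd_hom G H)
    (hphi : effective_equivalence phi) :
  homeomorphism (orbit_map phi).
Proof.
case: hphi => g [gphi phig]; split; first exact: orbit_map_continuous.
exists (localized_orbit_map g); split.
- exact: localized_orbit_map_continuous.
- move=> q; have := localized_orbit_map_eq gphi.
  by move=> /= /(congr1 (@^~ q)) /=; rewrite orbit_map_id.
- move=> q; have := localized_orbit_map_eq phig.
  by move=> /= /(congr1 (@^~ q)) /=; rewrite orbit_map_id.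
Qed.
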